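(* Let $A$ be a unital ring, let $S$ be a cancellative left Ore monoid with enveloping group $G=S^{-1}S$, and let $\alpha: S\rightarrow \mathrm{Endr}(A)$ be an action of $S$ on $A$ by injective unital homomorphisms. Then $$S^{\mathrm{op}}*_\alpha A*_\alpha S=(S_-AS_+)*_{\overline{\alpha}}G.$$
   Context: For a unital ring $A$, $\mathrm{Endr}(A)$ is the monoid of not necessarily unital ring endomorphisms of $A$; an action of a monoid $S$ on $A$ is a monoid homomorphism $\alpha: S\to \mathrm{Endr}(A)$, $s\mapsto\alpha_s$. Put $p_s=\alpha_s(1)$. A monoid $S$ is left Ore if for all $s,t\in S$ there are $\hat s,\hat t\in S$ with $\hat s t=\hat t s$. A cancellative left Ore monoid embeds in its group of left fractions (enveloping group) $G=S^{-1}S$. $S^{\mathrm{op}}*_\alpha A*_\alpha S$ is the unital ring $R$ with a unital ring homomorphism $\phi: A\to R$ and monoid homomorphisms $S^{\mathrm{op}}\to R$, $s\mapsto s_-$, and $S\to R$, $s\mapsto s_+$, universal with respect to: (1) $s_+\phi(a)=\phi(\alpha_s(a))s_+$; (2) $\phi(a)s_-=s_-\phi(\alpha_s(a))$; (3) $s_-s_+=1$; (4) $s_+s_-=\phi(p_s)$, for all $a\in A$, $s\in S$. Since the $\alpha_s$ are injective, $\phi$ is injective and $A$ is identified with $\phi(A)$. $S_-AS_+=\{s_-as_+ : s\in S, a\in A\}\subseteq R$; it is a unital subring of $R$ containing $A$. $S$ acts on it by $\overline{\alpha}_t(x)=t_+xt_-$. When the $\alpha_s$ are unital, each $\overline{\alpha}_t$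 is an automorphism of $S_-AS_+$, and $\overline{\alpha}$ also denotes the resulting action $G\to\mathrm{Aut}(S_-AS_+)$, $\overline{\alpha}_{s^{-1}t}=\overline{\alpha}_s^{-1}\overline{\alpha}_t$. For a group $G$ acting on a unital ring $C$ by automorphisms $\overline\alpha$, $C*_{\overline\alpha}G=\bigoplus_{g\in G}Cg$ is the skew group ring with $(cg)(dh)=c\,\overline\alpha_g(d)\,gh$. Equality means the canonical identification: the identity on $S_-AS_+$, with $s_+$ corresponding to $s\in G$ and $s_-$ to $s^{-1}\in G$. *)

(* Defs.v *)
From HB Require Import structures.
From mathcomp Require Import all_boot all_algebra finmap.
From mathcomp.classical Require Import boolp.
From mathcomp.multinomials Require Import monalg.

Set Implicit Arguments.
Unset Strict Implicit.
Unset Printing Implicit Defensive.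

Import GRing.Theory.

Local Open Scope ring_scope.

Definition cancellative (S : monoidType) : Prop :=
  (forall s t u : S, (s * t = s * u)%g -> t = u) /\
  (forall s t u : S, (t * s = u * s)%g -> t = u).

Definition left_ore (S : monoidType) : Prop :=
  forall s t : S, exists s' t' : S, (s' * t = t' * s)%g.

Record enveloping_group (S : monoidType) := EnvelopingGroup {
  env_group :> groupType;
  env_emb : UMagmaMorphism.type S env_group;
  env_emb_inj : injective env_emb;
  env_frac : forall g : env_group,
    exists s t : S, g = ((env_emb s)^-1 * env_emb t)%g
}.

(* The maps [act s] are ring endomorphisms that need not preserve 1. *)
Record endr_action (S : monoidType) (A : pzRingType) := EndrAction {
  act :> S -> {additive A -> A};
  act_mult : forall s, {morph act s : a b / a * b};
  act_id : forall a, act 1%g a = a;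
  act_comp : forall s t a, act (s * t)%g a = act s (act t a)
}.

Definition unital_action S A (alpha : endr_action S A) : Prop :=
  forall s, alpha s 1 = 1.

Definition injective_action S A (alpha : endr_action S A) : Prop :=
  forall s, injective (alpha s).

(* A unital ring R with a unital ring homomorphism A -> R and monoid
   homomorphisms S^op -> R, s |-> s_-, and S -> R, s |-> s_+, subject to the
   relations (1)-(4) in the last four fields. *)
Record crossed_rep S A (alpha : endr_action S A) := CrossedRep {
  cr_ring :> pzRingType;
  phi : {rmorphism A -> cr_ring};
  sm : S -> cr_ring;
  sp : S -> cr_ring;
  sm1 : sm 1%g = 1;
  smM : forall s t, sm (s * t)%g = sm t * sm s;
  sp1 : sp 1%g = 1;
  spM : forall s t, sp (s * t)%g = sp s * sp t;
  sp_phi : forall s a, sp s * phi a = phi (alpha s a) * sp s;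
  phi_sm : forall s a, phi a * sm s = sm s * phi (alpha s a);
  smp : forall s, sm s * sp s = 1;
  spm : forall s, sp s * sm s = phi (alpha s 1)
}.

Definition is_crossed_morphism S A (alpha : endr_action S A)
    (X Y : crossed_rep alpha) (f : {rmorphism X -> Y}) : Prop :=
  [/\ forall a, f (phi X a) = phi Y a,
      forall s, f (sm X s) = sm Y s
    & forall s, f (sp X s) = sp Y s].

(* [is_crossed_product X] says that X is S^op *_alpha A *_alpha S. *)
Definition is_crossed_product S A (alpha : endr_action S A)
    (X : crossed_rep alpha) : Prop :=
  forall Y : crossed_rep alpha,
    exists f : {rmorphism X -> Y}, is_crossed_morphism f /\
      forall f' : {rmorphism X -> Y}, is_crossed_morphism f' -> f' =1 f.

(* An action of a group G on the ring C by automorphisms; each [aut g] is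
   bijective with inverse [aut g^-1] by the last two fields. *)
Record aut_action (G : groupType) (C : pzRingType) := AutAction {
  aut :> G -> {rmorphism C -> C};
  aut_id : forall c, aut 1%g c = c;
  aut_comp : forall g h c, aut (g * h)%g c = aut g (aut h c)
}.

Section SkewGroupRing.

Variables (G : groupType) (C : pzRingType).

(* The additive group of finitely supported functions G -> C; the argument
   [beta] only serves to select the ring structure declared below. *)
Definition skew_group_ring of aut_action G C : Type := {malg C[G]}.

Variable beta : aut_action G C.

Local Notation CG := (skew_group_ring beta).

HB.instance Definition _ := Choice.on CG.
HB.instance Definition _ := GRing.Zmodule.on CG.

(* The element c g of the skew group ring. *)
Definition skew_term (c : C) (g : G) : CG := << c *g g >>.

Definition skew_one : CG := skew_term 1 1%g.

Definition skew_mul (x y : CG) : CG :=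
  \sum_(g <- msupp x) \sum_(h <- msupp y)
    skew_term (x@_g * beta g y@_h) (g * h)%g.

Lemma skew_term0 g : skew_term 0 g = 0.
Proof. exact: monalgU0. Qed.

Lemma skew_termD c d g : skew_term (c + d) g = skew_term c g + skew_term d g.
Proof. exact: monalgUD. Qed.

Lemma skew_mulE (d e : {fset G}) (x y : CG) :
  (msupp x `<=` d)%fset -> (msupp y `<=` e)%fset ->
  skew_mul x y =
  \sum_(g <- d) \sum_(h <- e) skew_term (x@_g * beta g y@_h) (g * h)%g.
Proof.
move=> le_d le_e; rewrite /skew_mul (big_fset_incl _ le_d) /=; last first.
  move=> g _ /mcoeff_outdom ->.
  by rewrite big1 // => h _; rewrite mul0r skew_term0.
apply: eq_bigr => g _; rewrite (big_fset_incl _ le_e) //=.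
move=> h _ /mcoeff_outdom ->.
by rewrite raddf0 mulr0 skew_term0.
Qed.

Lemma skew_mulDl : left_distributive skew_mul +%R.
Proof.
move=> x y z; pose d := (msupp x `|` msupp y)%fset.
rewrite (@skew_mulE d (msupp z)) ?fsubset_refl ?msuppD_le //.
rewrite (@skew_mulE d (msupp z) x) ?fsubset_refl ?fsubsetUl //.
rewrite (@skew_mulE d (msupp z) y) ?fsubset_refl ?fsubsetUr //.
rewrite -big_split /=; apply: eq_bigr => g _.
rewrite -big_split /=; apply: eq_bigr => h _.
by rewrite mcoeffD mulrDl skew_termD.
Qed.

Lemma skew_mulDr : right_distributive skew_mul +%R.
Proof.
move=> x y z; pose d := (msupp y `|` msupp z)%fset.
rewrite (@skew_mulE (msupp x) d) ?fsubset_refl ?msuppD_le //.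
rewrite (@skew_mulE (msupp x) d x y) ?fsubset_refl ?fsubsetUl //.
rewrite (@skew_mulE (msupp x) d x z) ?fsubset_refl ?fsubsetUr //.
rewrite -big_split /=; apply: eq_bigr => g _.
rewrite -big_split /=; apply: eq_bigr => h _.
by rewrite mcoeffD raddfD mulrDr skew_termD.
Qed.

Lemma skew_mul_term c d g h :
  skew_mul (skew_term c g) (skew_term d h) =
  skew_term (c * beta g d) (g * h)%g.
Proof.
rewrite (skew_mulE msuppU_le msuppU_le) !big_seq_fset1.
by rewrite !mcoeffUU.
Qed.

Lemma skew_sum_term (x : CG) :
  x = \sum_(g <- msupp x) skew_term x@_g g.
Proof. exact: monalgE. Qed.

Lemma skew_mul0l x : skew_mul 0 x = 0.
Proof. by apply: (addrI (skew_mul 0 x)); rewrite -skew_mulDl !addr0. Qed.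

Lemma skew_mul0r x : skew_mul x 0 = 0.
Proof. by apply: (addrI (skew_mul x 0)); rewrite -skew_mulDr !addr0. Qed.

Lemma skew_ind (P : CG -> Prop) :
  P 0 -> (forall x y, P x -> P y -> P (x + y)) ->
  (forall c g, P (skew_term c g)) -> forall x, P x.
Proof. by move=> P0 PD Pt x; rewrite [x]skew_sum_term; elim/big_ind: _. Qed.

Lemma skew_mulA : associative skew_mul.
Proof.
move=> x y z; elim/skew_ind: x => [|x x' IHx IHx'|a g].
- by rewrite !skew_mul0l.
- by rewrite !skew_mulDl IHx IHx'.
elim/skew_ind: y => [|y y' IHy IHy'|b h].
- by rewrite !(skew_mul0r, skew_mul0l).
- by rewrite !(skew_mulDl, skew_mulDr) IHy IHy'.
elim/skew_ind: z => [|z z' IHz IHz'|c k].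
- by rewrite !skew_mul0r.
- by rewrite !skew_mulDr IHz IHz'.
by rewrite !skew_mul_term rmorphM aut_comp mulrA mulgA.
Qed.

Lemma skew_mul1l : left_id skew_one skew_mul.
Proof.
elim/skew_ind => [|x y IHx IHy|c g]; first by rewrite skew_mul0r.
  by rewrite skew_mulDr IHx IHy.
by rewrite skew_mul_term aut_id mul1r mul1g.
Qed.

Lemma skew_mul1r : right_id skew_one skew_mul.
Proof.
elim/skew_ind => [|x y IHx IHy|c g]; first by rewrite skew_mul0l.
  by rewrite skew_mulDl IHx IHy.
by rewrite skew_mul_term rmorph1 mulr1 mulg1.
Qed.

HB.instance Definition _ := GRing.Zmodule_isPzRing.Build CG
  skew_mulA skew_mul1l skew_mul1r skew_mulDl skew_mulDr.

Lemma skew_termM c d g h :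
  skew_term c g * skew_term d h = skew_term (c * beta g d) (g * h)%g.
Proof. exact: skew_mul_term. Qed.

End SkewGroupRing.

Section CovariantSubring.

Variables (S : monoidType) (A : pzRingType) (alpha : endr_action S A).
Variables (ore : left_ore S) (X : crossed_rep alpha).

Local Notation phi := (phi X).
Local Notation sm := (sm X).
Local Notation sp := (sp X).

(* S_- A S_+; the unused left Ore argument is what the proof that this is a
   subring depends on. *)
Definition SAS of left_ore S : {pred X} :=
  fun x => `[< exists s a, x = sm s * phi a * sp s >].

Lemma SASP x :
  reflect (exists s a, x = sm s * phi a * sp s) (x \in SAS ore).
Proof. exact: asboolP. Qed.

Lemma SAS_mem s a : sm s * phi a * sp s \in SAS ore.
Proof. by apply/SASP; exists s, a. Qed.

Lemma sp_phi_sm s a : sp s * phi a * sm s = phi (alpha s a).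
Proof. by rewrite sp_phi -mulrA spm -rmorphM -act_mult mulr1. Qed.

Lemma SAS_up u s a :
  sm s * phi a * sp s = sm (u * s)%g * phi (alpha u a) * sp (u * s)%g.
Proof.
rewrite smM spM -sp_phi_sm !mulrA -(mulrA (sm s) (sm u)) smp mulr1.
by rewrite -(mulrA _ (sm u)) smp mulr1.
Qed.

Lemma SAS_common x y : x \in SAS ore -> y \in SAS ore ->
  exists s a b, x = sm s * phi a * sp s /\ y = sm s * phi b * sp s.
Proof.
move=> /SASP[s [a ->]] /SASP[t [b ->]]; have [s' [t' e]] := ore t s.
exists (s' * s)%g, (alpha s' a), (alpha t' b).
by split; [exact: SAS_up | rewrite e; exact: SAS_up].
Qed.

Lemma SAS_subring : subring_closed (SAS ore).
Proof.
split=> [|x y xS yS|x y xS yS].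
- by apply/SASP; exists 1%g, 1; rewrite rmorph1 mulr1 smp.
- have [s [a [b [-> ->]]]] := SAS_common xS yS.
  by rewrite -mulrBl -mulrBr -rmorphB SAS_mem.
- have [s [a [b [-> ->]]]] := SAS_common xS yS.
  have -> : sm s * phi a * sp s * (sm s * phi b * sp s) =
            sm s * (phi a * (sp s * sm s) * phi b) * sp s by rewrite !mulrA.
  by rewrite spm -!rmorphM SAS_mem.
Qed.

Record SAS_ring : predArgType :=
  SASElt { SAS_val :> cr_ring X; _ : SAS_val \in SAS ore }.

HB.instance Definition _ := [isSub for SAS_val].
HB.instance Definition _ := [Choice of SAS_ring by <:].
HB.instance Definition _ :=
  GRing.SubChoice_isSubPzRing.Build X (SAS ore) SAS_ring SAS_subring.

Lemma SAS_val_inj : injective (SAS_val : SAS_ring -> X).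
Proof. exact: val_inj. Qed.

Lemma spm_ore s t s' t' : (s' * t = t' * s)%g ->
  sp t * sm s = sm s' * phi (alpha (s' * t)%g 1) * sp t'.
Proof.
move=> e; rewrite -spm {2}e spM smM !mulrA smp mul1r.
by rewrite -mulrA smp mulr1.
Qed.

Lemma bar_act_subproof t (x : SAS_ring) : sp t * val x * sm t \in SAS ore.
Proof.
case: x => _ /= /SASP[s [a ->]]; have [s' [t' e]] := ore s t.
have -> : sp t * (sm s * phi a * sp s) * sm t =
          (sp t * sm s) * phi a * (sp s * sm t) by rewrite !mulrA.
rewrite (spm_ore e) (spm_ore (esym e)) -e.
set p := phi (alpha _ 1).
have -> : sm s' * p * sp t' * phi a * (sm t' * p * sp s') =
          sm s' * (p * (sp t' * phi a * sm t') * p) * sp s' by rewrite !mulrA.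
by rewrite sp_phi_sm -!rmorphM SAS_mem.
Qed.

Lemma bar_inv_subproof t (x : SAS_ring) : sm t * val x * sp t \in SAS ore.
Proof.
case: x => _ /= /SASP[s [a ->]].
suff -> : sm t * (sm s * phi a * sp s) * sp t =
          sm (s * t)%g * phi a * sp (s * t)%g by exact: SAS_mem.
by rewrite smM spM !mulrA.
Qed.

Definition bar_act t (x : SAS_ring) : SAS_ring := SASElt (bar_act_subproof t x).

Definition bar_inv t (x : SAS_ring) : SAS_ring := SASElt (bar_inv_subproof t x).

End CovariantSubring.

Section GroupAction.

Variables (S : monoidType) (A : pzRingType) (alpha : endr_action S A).
Variables (unital : unital_action alpha) (ore : left_ore S).
Variables (G : enveloping_group S) (X : crossed_rep alpha).

Local Notation C := (SAS_ring ore X).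
Local Notation sm := (sm X).
Local Notation sp := (sp X).
Local Notation iota := (env_emb G).

Let iotaM s t : iota (s * t)%g = (iota s * iota t)%g.
Proof. exact: gmulfM. Qed.

Lemma unital_spm s : sp s * sm s = 1.
Proof. by rewrite spm unital rmorph1. Qed.

Lemma bar_actK s : cancel (@bar_act _ _ _ ore X s) (@bar_inv _ _ _ ore X s).
Proof.
move=> x; apply: SAS_val_inj => /=.
by rewrite !mulrA smp mul1r -mulrA smp mulr1.
Qed.

Lemma bar_invK s : cancel (@bar_inv _ _ _ ore X s) (@bar_act _ _ _ ore X s).
Proof.
move=> x; apply: SAS_val_inj => /=.
by rewrite !mulrA unital_spm mul1r -mulrA unital_spm mulr1.
Qed.

Lemma env_fracE (g : G) :
  exists st : S * S, g == ((iota st.1)^-1 * iota st.2)%g.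
Proof. by have [s [t ->]] := env_frac g; exists (s, t). Qed.

Definition num_den (g : G) : S * S := xchoose (env_fracE g).

Lemma num_denP g : g = ((iota (num_den g).1)^-1 * iota (num_den g).2)%g.
Proof. exact/eqP/(xchooseP (env_fracE g)). Qed.

(* The unit s_- t_+ of R attached to s^-1 t; it is independent of the chosen
   fraction and conjugation by it is [bar_inv s \o bar_act t]. *)
Definition frac_unit s t : X := sm s * sp t.
Local Notation u := frac_unit.

Lemma frac_up w s t : u (w * s)%g (w * t)%g = u s t.
Proof. by rewrite /frac_unit smM spM !mulrA -(mulrA _ _ (sp w)) smp mulr1. Qed.

Lemma frac_eq s t s' t' :
  ((iota s)^-1 * iota t = (iota s')^-1 * iota t')%g -> u s t = u s' t'.
Proof.
move=> e; have [w' [w ws]] := ore s s'.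
suff wt : (w * t = w' * t')%g by rewrite -(frac_up w) -(frac_up w' s') wt ws.
apply: (@env_emb_inj _ G); rewrite !iotaM.
have -> : iota t = (iota s * ((iota s')^-1 * iota t'))%g.
  by rewrite -e mulgA mulgV mul1g.
by rewrite !mulgA -(iotaM w s) -ws iotaM mulgK.
Qed.

Lemma frac_mul s t s' t' w w' : (w * t = w' * s')%g ->
  u s t * u s' t' = u (w * s)%g (w' * t')%g.
Proof.
move=> e; rewrite -(frac_up w s) -(frac_up w' s') e /frac_unit !mulrA.
by rewrite -(mulrA _ _ (sm _)) unital_spm mulr1.
Qed.

Lemma frac_inv s t : u s t * u t s = 1.
Proof. by rewrite (@frac_mul _ _ _ _ 1%g 1%g) // !mul1g /frac_unit smp. Qed.

Definition bar_fun (g : G) (x : C) : C :=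
  bar_inv (num_den g).1 (bar_act (num_den g).2 x).

Lemma bar_fun_val g s t x : g = ((iota s)^-1 * iota t)%g ->
  val (bar_fun g x) = u s t * val x * u t s.
Proof.
move=> gE; set s0 := (num_den g).1; set t0 := (num_den g).2.
have e : ((iota s0)^-1 * iota t0 = (iota s)^-1 * iota t)%g.
  by rewrite -num_denP.
have -> : u t s = u t0 s0.
  by apply: frac_eq; rewrite -[LHS]invgK invgM invgK -e invgM invgK.
by rewrite -(frac_eq e) /frac_unit !mulrA /= !mulrA.
Qed.

Lemma bar_funE s t x :
  bar_fun ((iota s)^-1 * iota t)%g x = bar_inv s (bar_act t x).
Proof.
by apply: SAS_val_inj; rewrite -/(val _) (bar_fun_val _ erefl) /frac_unit
  /= !mulrA.
Qed.

Fact bar_fun_additive g : zmod_morphism (bar_fun g).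
Proof.
move=> x y; apply: val_inj; rewrite rmorphB /= -!mulrA.
by rewrite !(mulrBl, mulrBr).
Qed.

Fact bar_fun_monoid g : monoid_morphism (bar_fun g).
Proof.
split=> [|x y]; apply: val_inj.
  by rewrite (bar_fun_val _ (num_denP g)) rmorph1 mulr1 frac_inv.
have valM (a b : C) : val (a * b) = val a * val b by exact: rmorphM.
rewrite valM !(bar_fun_val _ (num_denP g)) valM.
move: (frac_inv (num_den g).2 (num_den g).1).
move: (u (num_den g).1 _) (u (num_den g).2 _) => a b ba.
by rewrite !mulrA -(mulrA _ b a) ba mulr1.
Qed.

HB.instance Definition _ g :=
  GRing.isZmodMorphism.Build C C (bar_fun g) (bar_fun_additive g).
HB.instance Definition _ g :=
  GRing.isMonoidMorphism.Build C C (bar_fun g) (bar_fun_monoid g).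

Fact bar_fun1 x : bar_fun 1%g x = x.
Proof.
apply: val_inj; rewrite (@bar_fun_val 1%g 1%g 1%g) ?mulVg //.
by rewrite /frac_unit smp mul1r mulr1.
Qed.

Fact bar_funM g h x : bar_fun (g * h)%g x = bar_fun g (bar_fun h x).
Proof.
have [s [t gE]] := env_frac g; have [s' [t' hE]] := env_frac h.
have [w [w' e]] := ore s' t.
have ghE : (g * h = (iota (w * s)%g)^-1 * iota (w' * t')%g)%g.
  rewrite gE hE !iotaM invgM -!mulgA; congr (_ * _)%g.
  rewrite !mulgA; congr (_ * _)%g; apply: (canLR (mulgK _)).
  by rewrite -mulgA; apply: (canRL (mulKg _)); rewrite -!iotaM e.
apply: val_inj; rewrite (bar_fun_val _ ghE) (bar_fun_val _ gE).
rewrite (bar_fun_val _ hE) -(frac_mul s t' e) -(frac_mul t' s (esym e)).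
by rewrite !mulrA.
Qed.

(* The action of G on S_- A S_+, with s^-1 t acting as in [bar_funE]. *)
Definition bar_action : aut_action G C := AutAction bar_fun1 bar_funM.

End GroupAction.

(* Main.v *)
Require Import Defs.
From HB Require Import structures.
From mathcomp Require Import all_boot all_algebra finmap.
From mathcomp.multinomials Require Import monalg.

(** The skew group ring carries the generators [phi a * 1], [1 * s] and
    [1 * s^-1], which satisfy the relations (1)-(4), so universality gives
    [Psi : R -> C * G].  Conversely [s^-1 t |-> s_- t_+] is a well-defined
    homomorphism from [G] to the units of [R] whose conjugations induce the
    action of [G] on [C = S_- A S_+], so it extends to [Theta : C * G -> R].
    [Theta \o Psi] fixes the generators, hence is the identity by universality;
    [Psi \o Theta] is the identity on the terms [c g]. *)

Set Implicit Arguments.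
Unset Strict Implicit.
Unset Printing Implicit Defensive.

Import GRing.Theory.
Local Open Scope ring_scope.

Section SkewLift.

Variables (G : groupType) (C T : pzRingType) (beta : aut_action G C).
Variables (f : {rmorphism C -> T}) (u : G -> T).
Hypothesis u1 : u 1%g = 1.
Hypothesis uM : forall g h, u (g * h)%g = u g * u h.
Hypothesis u_conj : forall g c, u g * f c = f (beta g c) * u g.

(* [monalg.mmap] is not available here: it requires [T] to be nontrivial. *)
Definition skew_lift (x : skew_group_ring beta) : T :=
  \sum_(g <- msupp x) f x@_g * u g.

Lemma skew_liftE (d : {fset G}) (x : skew_group_ring beta) :
  (msupp x `<=` d)%fset -> skew_lift x = \sum_(g <- d) f x@_g * u g.
Proof.
move=> le_d; rewrite /skew_lift (big_fset_incl _ le_d) // => g _.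
by move=> /mcoeff_outdom ->; rewrite raddf0 mul0r.
Qed.

Lemma skew_lift_term c g : skew_lift (skew_term beta c g) = f c * u g.
Proof. by rewrite (skew_liftE msuppU_le) big_seq_fset1 mcoeffUU. Qed.

Fact skew_lift_additive : zmod_morphism skew_lift.
Proof.
move=> x y; pose d := (msupp x `|` msupp y)%fset.
rewrite (@skew_liftE d (x - y)) ?msuppB_le //.
rewrite (@skew_liftE d x) ?fsubsetUl // (@skew_liftE d y) ?fsubsetUr //.
rewrite -sumrB; apply: eq_bigr => g _.
by rewrite mcoeffB raddfB mulrBl.
Qed.

HB.instance Definition _ :=
  GRing.isZmodMorphism.Build (skew_group_ring beta) T skew_lift
    skew_lift_additive.

Lemma skew_liftD : {morph skew_lift : x y / x + y}.
Proof. exact: raddfD. Qed.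

Fact skew_lift_monoid : monoid_morphism skew_lift.
Proof.
split=> [|x y]; first by rewrite skew_lift_term rmorph1 u1 mulr1.
elim/skew_ind: x => [|x x' IHx IHx'|c g].
- by rewrite mul0r raddf0 mul0r.
- by rewrite mulrDl !skew_liftD IHx IHx' mulrDl.
elim/skew_ind: y => [|y y' IHy IHy'|d h].
- by rewrite mulr0 raddf0 mulr0.
- by rewrite mulrDr !skew_liftD IHy IHy' mulrDr.
rewrite skew_termM !skew_lift_term uM rmorphM -!mulrA; congr (_ * _).
by rewrite !mulrA u_conj.
Qed.

End SkewLift.

Section Identification.

Variables (S : monoidType) (A : pzRingType) (alpha : endr_action S A).
Variables (unital : unital_action alpha) (ore : left_ore S).
Variables (G : enveloping_group S) (R : crossed_rep alpha).

Local Notation C := (SAS_ring ore R).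
Local Notation iota := (env_emb G).
Local Notation incl := (@SAS_val S A alpha ore R).
Local Notation beta := (bar_action unital ore G R).
Local Notation term := (skew_term beta).

Let iota1 : iota 1%g = 1%g.
Proof. exact: gmulf1. Qed.

Let iotaM s t : iota (s * t)%g = (iota s * iota t)%g.
Proof. exact: gmulfM. Qed.

Definition env_unit (g : G) : R := frac_unit R (num_den g).1 (num_den g).2.

Lemma env_unitE g s t : g = ((iota s)^-1 * iota t)%g ->
  env_unit g = sm R s * sp R t.
Proof. by move=> gE; apply: (frac_eq ore (G := G)); rewrite -num_denP. Qed.

Lemma env_unit_iota s : env_unit (iota s) = sp R s.
Proof.
by rewrite (@env_unitE _ 1%g s) ?sm1 ?mul1r // iota1 invg1 mul1g.
Qed.

Lemma env_unit_iotaV s : env_unit (iota s)^-1%g = sm R s.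
Proof. by rewrite (@env_unitE _ s 1%g) ?sp1 ?mulr1 // iota1 mulg1. Qed.

Lemma env_unit1 : env_unit 1%g = 1.
Proof. by rewrite -iota1 env_unit_iota sp1. Qed.

Lemma env_unitM g h : env_unit (g * h)%g = env_unit g * env_unit h.
Proof.
have [s [t gE]] := env_frac g; have [s' [t' hE]] := env_frac h.
have [w [w' e]] := ore s' t.
rewrite (env_unitE gE) (env_unitE hE) -!/(frac_unit _ _ _).
rewrite (frac_mul unital R s t' e); apply: env_unitE.
rewrite gE hE; have -> : iota s' = ((iota w')^-1 * (iota w * iota t))%g.
  by apply: (canRL (mulKg _)); rewrite -!iotaM e.
by rewrite !iotaM !invgM invgK -!mulgA mulVKg.
Qed.

Lemma env_unit_conj g (x : C) :
  env_unit g * SAS_val x = SAS_val (beta g x) * env_unit g.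
Proof.
rewrite -/(val (beta g x)) (bar_fun_val x (num_denP g)) /env_unit.
by rewrite -[RHS]mulrA (frac_inv unital) mulr1.
Qed.

Fact SAS_val_additive : zmod_morphism incl.
Proof. by move=> x y; exact: (raddfB val). Qed.

Fact SAS_val_monoid : monoid_morphism incl.
Proof. by split=> [|x y]; [exact: (rmorph1 val) | exact: (rmorphM val)]. Qed.

HB.instance Definition _ :=
  GRing.isZmodMorphism.Build C R incl SAS_val_additive.
HB.instance Definition _ :=
  GRing.isMonoidMorphism.Build C R incl SAS_val_monoid.

Definition skew_to_crossed (x : skew_group_ring beta) : R :=
  skew_lift incl env_unit x.

Lemma skew_to_crossed_term x g :
  skew_to_crossed (term x g) = incl x * env_unit g.
Proof. exact: skew_lift_term. Qed.

Fact skew_to_crossed_additive : zmod_morphism skew_to_crossed.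
Proof. exact: skew_lift_additive. Qed.

Fact skew_to_crossed_monoid : monoid_morphism skew_to_crossed.
Proof. exact: skew_lift_monoid env_unit1 env_unitM env_unit_conj. Qed.

HB.instance Definition _ :=
  GRing.isZmodMorphism.Build (skew_group_ring beta) R skew_to_crossed
    skew_to_crossed_additive.
HB.instance Definition _ :=
  GRing.isMonoidMorphism.Build (skew_group_ring beta) R skew_to_crossed
    skew_to_crossed_monoid.

Fact phi_in_SAS a : phi R a \in SAS ore.
Proof. by apply/SASP; exists 1%g, a; rewrite sm1 sp1 mul1r mulr1. Qed.

Definition SAS_phi a : C := SASElt (phi_in_SAS a).

Definition skew_phi a : skew_group_ring beta := term (SAS_phi a) 1%g.

Fact skew_phi_additive : zmod_morphism skew_phi.
Proof.
move=> a b; rewrite -[LHS](addrK (skew_phi b)) -skew_termD.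
by congr (term _ _ - _); apply: SAS_val_inj; rewrite raddfD /= -raddfD subrK.
Qed.

Fact skew_phi_monoid : monoid_morphism skew_phi.
Proof.
split=> [|a b]; first by congr term; apply: SAS_val_inj; rewrite /= !rmorph1.
rewrite skew_termM mulg1 aut_id; congr term.
by apply: SAS_val_inj; rewrite /= !rmorphM.
Qed.

HB.instance Definition _ :=
  GRing.isZmodMorphism.Build A (skew_group_ring beta) skew_phi
    skew_phi_additive.
HB.instance Definition _ :=
  GRing.isMonoidMorphism.Build A (skew_group_ring beta) skew_phi
    skew_phi_monoid.

Lemma bar_action_iota s a : beta (iota s) (SAS_phi a) = SAS_phi (alpha s a).
Proof.
apply: SAS_val_inj; have := env_unit_conj (iota s) (SAS_phi a).
rewrite env_unit_iota /= sp_phi => /(congr1 ( *%R^~ (sm R s))).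
by rewrite -[LHS]mulrA -[RHS]mulrA (unital_spm unital) !mulr1.
Qed.

Lemma bar_action_iotaV s (x y : C) :
  SAS_val x = sm R s * SAS_val y * sp R s -> beta (iota s)^-1%g y = x.
Proof.
move=> xE; apply: SAS_val_inj; have := env_unit_conj (iota s)^-1%g y.
rewrite env_unit_iotaV xE => /(congr1 ( *%R^~ (sp R s))).
by rewrite -[RHS]mulrA smp mulr1.
Qed.

Fact skew_sp_phi s a :
  term 1 (iota s) * skew_phi a = skew_phi (alpha s a) * term 1 (iota s).
Proof.
by rewrite !skew_termM mulg1 mul1g rmorph1 mulr1 mul1r bar_action_iota.
Qed.

Fact skew_phi_sm s a :
  skew_phi a * term 1 (iota s)^-1%g
  = term 1 (iota s)^-1%g * skew_phi (alpha s a).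
Proof.
rewrite !skew_termM mulg1 mul1g rmorph1 mulr1 mul1r -bar_action_iota.
by rewrite -aut_comp mulVg aut_id.
Qed.

Lemma term1M g h : term 1 g * term 1 h = term 1 (g * h)%g.
Proof. by rewrite skew_termM rmorph1 mulr1. Qed.

Definition skew_crossed_rep : crossed_rep alpha.
Proof.
refine (@CrossedRep _ _ alpha (skew_group_ring beta) skew_phi
  (fun s => term 1 (iota s)^-1%g) (fun s => term 1 (iota s))
  _ _ _ _ skew_sp_phi skew_phi_sm _ _).
- by rewrite iota1 invg1.
- by move=> s t; rewrite term1M iotaM invgM.
- by rewrite iota1.
- by move=> s t; rewrite term1M iotaM.
- by move=> s; rewrite term1M mulVg.
- by move=> s; rewrite term1M mulgV unital rmorph1.
Defined.

Section Inverse.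

Variable Psi : {rmorphism R -> skew_crossed_rep}.
Hypothesis PsiP : is_crossed_morphism Psi.

Lemma crossed_to_skew_SAS (x : C) : Psi (SAS_val x) = term x 1%g.
Proof.
have [Pphi Psm Psp] := PsiP; have /SASP[s [a xE]] := valP x.
rewrite -/(val x) xE !rmorphM Pphi Psm Psp /=.
rewrite [LHS](_ : _ = term 1 (iota s)^-1%g * skew_phi a * term 1 (iota s)) //.
rewrite !skew_termM mulg1 mulVg rmorph1 mulr1 mul1r; congr term.
exact: bar_action_iotaV.
Qed.

Lemma crossed_to_skew_unit g : Psi (env_unit g) = term 1 g.
Proof.
have [_ Psm Psp] := PsiP; have [s [t gE]] := env_frac g.
by rewrite (env_unitE gE) rmorphM Psm Psp [LHS]term1M -gE.
Qed.

Lemma skew_to_crossedK : cancel skew_to_crossed Psi.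
Proof.
elim/skew_ind => [|x y IHx IHy|c g]; first by rewrite !rmorph0.
  by rewrite !rmorphD IHx IHy.
rewrite skew_to_crossed_term rmorphM crossed_to_skew_SAS crossed_to_skew_unit.
by rewrite [LHS]skew_termM rmorph1 mulr1 mul1g.
Qed.

Lemma crossed_to_skewK : is_crossed_product R -> cancel Psi skew_to_crossed.
Proof.
move=> R_univ x; have [Pphi Psm Psp] := PsiP; have [f [_ f_uniq]] := R_univ R.
pose h : {rmorphism R -> R} := skew_to_crossed \o Psi.
have hP : is_crossed_morphism h.
  split=> [a|s|s] /=.
  - by rewrite Pphi skew_to_crossed_term env_unit1 mulr1.
  - by rewrite Psm skew_to_crossed_term rmorph1 mul1r env_unit_iotaV.
  - by rewrite Psp skew_to_crossed_term rmorph1 mul1r env_unit_iota.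
have idP : is_crossed_morphism (idfun : {rmorphism R -> R}) by [].
by rewrite -[LHS]/(h x) (f_uniq h hP) -(f_uniq _ idP).
Qed.

End Inverse.

End Identification.

Theorem corollary3p11 (A : pzRingType) (S : monoidType)
    (S_cancel : cancellative S) (S_ore : left_ore S)
    (G : enveloping_group S)
    (alpha : endr_action S A)
    (alpha_inj : injective_action alpha) (alpha_unital : unital_action alpha)
    (R : crossed_rep alpha) (R_univ : is_crossed_product R) :
  let beta := bar_action alpha_unital S_ore G R in
  exists Psi : {rmorphism R -> skew_group_ring beta},
    [/\ bijective Psi,
        forall x : SAS_ring S_ore R, Psi (SAS_val x) = skew_term beta x 1%g,
        forall s : S, Psi (sp R s) = skew_term beta 1 (env_emb G s)
      & forall s : S, Psi (sm R s) = skew_term beta 1 (env_emb G s)^-1%g].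
Proof.
move=> beta.
have [Psi [PsiP _]] := R_univ (skew_crossed_rep alpha_unital S_ore G R).
exists Psi; have [_ Psm Psp] := PsiP; split=> //.
- exact: Bijective (crossed_to_skewK PsiP R_univ) (skew_to_crossedK PsiP).
- exact: crossed_to_skew_SAS PsiP.
Qed.
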